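(* For every $n\ge 1$, the statistic $\mathrm{rix}$ is $1$-mesic under valley-hopping on $\mathfrak{S}_n$: for every valley-hopping orbit $\Pi\subseteq\mathfrak{S}_n$, \[ \frac{1}{|\Pi|}\sum_{\pi\in\Pi}\mathrm{rix}(\pi)=1 . \]
   Context: Permutations $\pi=\pi_1\cdots\pi_n\in\mathfrak{S}_n$ are written in one-line notation, with the convention $\pi_0=\pi_{n+1}=\infty$. A letter $\pi_i$ is a descent if $\pi_i>\pi_{i+1}$ and an ascent if $\pi_i<\pi_{i+1}$ (so the last letter is always an ascent). $\pi_i$ is a peak if $\pi_{i-1}<\pi_i>\pi_{i+1}$, a valley if $\pi_{i-1}>\pi_i<\pi_{i+1}$, a double ascent if $\pi_{i-1}<\pi_i<\pi_{i+1}$, a double descent if $\pi_{i-1}>\pi_i>\pi_{i+1}$. Rix-factorization: each $\pi$ is written uniquely as $\pi=\alpha_1\cdots\alpha_k\beta$ by: (1) set $w:=\pi$, $i:=0$; (2) if $w$ is increasing, set $\beta:=w$ and stop; otherwise increase $i$ by 1, let $x$ be the largest descent of $w$ (descent of the word $w$, i.e. a letter larger than its right neighbour in $w$) and write $w=w'xw''$; (3) if $w'$ is empty set $\beta:=w$ and stop; otherwise set $\alpha_i:=w'x$, $w:=w''$ and return to (2). Let $\beta_1(\pi)$ denote the first letter of $\beta$. A rixed point of $\pi$ is a letter in the maximal increasing suffix of $\pi$ that is not smaller than $\beta_1(\pi)$; $\mathrm{Rix}(\pi)$ is the set of rixed points and $\mathrm{rix}(\pi)=|\mathrm{Rix}(\pi)|$.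 Valley-hopping: for $x\in[n]$ write $\pi=w_1w_2xw_4w_5$ where $w_2$ (resp. $w_4$) is the maximal consecutive subword immediately to the left (resp. right) of $x$ all of whose letters are smaller than $x$. Set $\varphi_x(\pi)=w_1w_4xw_2w_5$ if $x$ is a double ascent or double descent of $\pi$, and $\varphi_x(\pi)=\pi$ if $x$ is a peak or valley. The $\varphi_x$ are commuting involutions; for $S\subseteq[n]$ put $\varphi_S=\prod_{x\in S}\varphi_x$. This $\mathbb{Z}_2^n$-action is valley-hopping; the orbit of $\pi$ is $\{\varphi_S(\pi):S\subseteq[n]\}$. A statistic is $c$-mesic under an action if its average over every orbit equals $c$. *)

(* Defs.v *)
From mathcomp Require Import all_boot all_order all_algebra all_fingroup.
From mathcomp Require Import zify.

Set Implicit Arguments.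
Unset Strict Implicit.
Unset Printing Implicit Defensive.

Import GRing.Theory.

(* Letters are 0, ..., n-1 instead of 1, ..., n; only their order matters. *)
Definition word n (pi : 'S_n) : seq nat := [seq val (pi i) | i <- enum 'I_n].

(* [None] stands for infinity. *)
Definition lt_inf (a b : option nat) : bool :=
  match a, b with
  | Some x, Some y => x < y
  | Some _, None => true
  | None, _ => false
  end.

(* Positions are 1-based: [letter w i] is [w_i], with w_0 = w_(n+1) = infinity
   coming from the leading [None] and from the default value of [nth]. *)
Definition letter (w : seq nat) (i : nat) : option nat :=
  nth None (None :: map Some w) i.

Definition position (x : nat) (w : seq nat) : nat := (index x w).+1.

Definition double_ascent (w : seq nat) (x : nat) : bool :=
  let i := position x w in
  lt_inf (letter w i.-1) (letter w i) && lt_inf (letter w i) (letter w i.+1).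

Definition double_descent (w : seq nat) (x : nat) : bool :=
  let i := position x w in
  lt_inf (letter w i) (letter w i.-1) && lt_inf (letter w i.+1) (letter w i).

(* w = w1 ++ w2 ++ x :: w4 ++ w5, where w2 and w4 are the maximal runs of
   letters smaller than x on either side of x. *)
Definition hop_word (x : nat) (w : seq nat) : seq nat :=
  let l := take (index x w) w in
  let r := drop (index x w).+1 w in
  let a := size l - find (leq x) (rev l) in
  let b := find (leq x) r in
  let w1 := take a l in let w2 := drop a l in
  let w4 := take b r in let w5 := drop b r in
  if double_ascent w x || double_descent w x
  then w1 ++ w4 ++ x :: w2 ++ w5 else w.

Lemma hop_word_perm x w : x \in w -> perm_eq (hop_word x w) w.
Proof.
move=> xw; rewrite /hop_word; case: ifP => // _.
set l := take _ w; set r := drop _ w; set a := (_ - _)%N; set b := find _ r.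
have -> : w = (take a l ++ drop a l) ++ x :: (take b r ++ drop b r).
  rewrite !cat_take_drop -{1}(cat_take_drop (index x w) w).
  by rewrite (drop_nth x) ?index_mem ?nth_index.
by apply/seq.permP => p; rewrite !count_cat /= !count_cat; lia.
Qed.

Lemma size_word n (pi : 'S_n) : size (word pi) = n.
Proof. by rewrite size_map size_enum_ord. Qed.

Lemma nth_word n (pi : 'S_n) (i : 'I_n) : nth 0 (word pi) i = pi i.
Proof. by rewrite (nth_map i) ?size_enum_ord // nth_ord_enum. Qed.

Lemma word_uniq n (pi : 'S_n) : uniq (word pi).
Proof.
by rewrite map_inj_uniq ?enum_uniq // => i j /val_inj; apply: perm_inj.
Qed.

Lemma mem_word n (pi : 'S_n) (x : nat) : (x \in word pi) = (x < n).
Proof.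
apply/mapP/idP => [[i _ ->] | xn]; first exact: ltn_ord.
by exists ((pi^-1)%g (Ordinal xn)); rewrite ?mem_enum ?permKV.
Qed.

(* By [val_hop_fun] the default value of [insubd] is never used; [word_hop]
   characterizes the resulting permutation. *)
Definition hop_fun n (x : 'I_n) (pi : 'S_n) (i : 'I_n) : 'I_n :=
  insubd (pi i) (nth 0 (hop_word x (word pi)) i).

Lemma hop_wordP n (x : 'I_n) (pi : 'S_n) :
  perm_eq (hop_word x (word pi)) (word pi).
Proof. by apply: hop_word_perm; rewrite mem_word. Qed.

Lemma val_hop_fun n (x : 'I_n) (pi : 'S_n) (i : 'I_n) :
  hop_fun x pi i = nth 0 (hop_word x (word pi)) i :> nat.
Proof.
rewrite val_insubd -(mem_word pi) -(perm_mem (hop_wordP x pi)) mem_nth //.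
by rewrite (perm_size (hop_wordP x pi)) size_word.
Qed.

Lemma hop_fun_inj n (x : 'I_n) (pi : 'S_n) : injective (hop_fun x pi).
Proof.
have sz : size (hop_word x (word pi)) = n.
  by rewrite (perm_size (hop_wordP x pi)) size_word.
move=> i j /(congr1 (@nat_of_ord n)); rewrite !val_hop_fun => /eqP.
rewrite nth_uniq ?sz //; first by move/eqP/val_inj.
by rewrite (perm_uniq (hop_wordP x pi)) word_uniq.
Qed.

Definition hop n (x : 'I_n) (pi : 'S_n) : 'S_n := perm (@hop_fun_inj n x pi).

Lemma word_hop n (x : 'I_n) (pi : 'S_n) :
  word (hop x pi) = hop_word x (word pi).
Proof.
have sz : size (hop_word x (word pi)) = n.
  by rewrite (perm_size (hop_wordP x pi)) size_word.
apply: (@eq_from_nth _ 0); rewrite size_word ?sz // => i lt_in.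
by rewrite (nth_word _ (Ordinal lt_in)) permE val_hop_fun.
Qed.

(* The maps [hop x] commute, so the order of composition is immaterial. *)
Definition hop_set n (S : {set 'I_n}) (pi : 'S_n) : 'S_n :=
  foldr (@hop n) pi (enum S).

Definition hop_orbit n (pi : 'S_n) : {set 'S_n} :=
  [set hop_set S pi | S : {set 'I_n}].

Definition hop_orbits n : {set {set 'S_n}} :=
  [set hop_orbit pi | pi : 'S_n].

(* The last letter of the word w itself is not a descent of w. *)
Definition descents (w : seq nat) : seq nat :=
  [seq p.1 | p <- zip w (behead w) & p.2 < p.1].

(* The pair ([:: alpha_1; ...; alpha_k], beta).  Every recursive call is on a
   strictly shorter word, so fuel [size w] suffices. *)
Fixpoint rix_fact_rec (fuel : nat) (w : seq nat) : seq (seq nat) * seq nat :=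
  if fuel is fuel'.+1 then
    if sorted ltn w then ([::], w) else
    let i := index (\max_(x <- descents w) x) w in
    if i == 0 then ([::], w) else
    let: (alphas, beta) := rix_fact_rec fuel' (drop i.+1 w) in
    (take i.+1 w :: alphas, beta)
  else ([::], w).

Definition rix_factorization (w : seq nat) : seq (seq nat) * seq nat :=
  rix_fact_rec (size w) w.

(* The default value of [head] is used only for the empty word. *)
Definition beta1 (w : seq nat) : nat := head 0 (rix_factorization w).2.

Definition max_increasing_suffix (w : seq nat) : seq nat :=
  drop (find (fun k => sorted ltn (drop k w)) (iota 0 (size w))) w.

Definition Rix n (pi : 'S_n) : {set 'I_n} :=
  [set x : 'I_n | (val x \in max_increasing_suffix (word pi))
                  && (beta1 (word pi) <= x)].

Definition rix n (pi : 'S_n) : nat := #|Rix pi|.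

Definition mesic (T : finType) (orbits : {set {set T}}) (f : T -> rat)
    (c : rat) : Prop :=
  forall O : {set T}, O \in orbits ->
    ((#|O|%:R)^-1 * \sum_(x in O) f x = c)%R.

(* Main.v *)
Require Import Defs.
From mathcomp Require Import all_boot all_order all_algebra all_fingroup.
From mathcomp Require Import zify.

Set Implicit Arguments.
Unset Strict Implicit.
Unset Printing Implicit Defensive.

(* Let y be the largest letter of a word w = A y B.  When both A and B are
   nonempty, y is a peak, and the rix-factorization of w consists of A y followed
   by that of B, so rix w = rix B.  When B is empty, rix w = rix A + 1, and when
   only A is empty, rix w = 0.  In the last two cases (for w of length > 1)
   hopping y exchanges A y and y A.  Letters of A and of B hop inside A and inside
   B, so by induction the average over an orbit is the average over the orbit of B
   in the first case, and (0 + (1 + 1)) / 2 = 1 otherwise.  The recursion runs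
   along the decreasing binary tree of w, whose root is its largest letter. *)

(** * Descents and sortedness around a largest letter *)

Definition below (y : nat) (w : seq nat) : bool := all (fun x => x < y) w.

Lemma below_notin y w : below y w -> y \notin w.
Proof. by move=> /allP yw; apply/negP => /yw; rewrite ltnn. Qed.

Lemma descents_cons2 a b s :
  descents (a :: b :: s) =
  if b < a then a :: descents (b :: s) else descents (b :: s).
Proof. by rewrite /descents /=; case: ifP. Qed.

(** A descent has a right neighbour, so its first occurrence comes before the last position; cutting
    after it leaves a nonempty remainder. *)
Lemma index_descent x w : x \in descents w -> (index x w).+1 < size w.
Proof.
elim: w => [|a [|b s] IHs] //; rewrite descents_cons2 => xds.
have [<-|ne] := eqVneq a x; first by rewrite /= eqxx.
have {}xds : x \in descents (b :: s).
  by move: xds; case: ifP => // _; rewrite inE eq_sym (negPf ne).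
by rewrite [index _ _]/= (negPf ne); apply: IHs.
Qed.

Lemma mem_descents x w : x \in descents w -> x \in w.
Proof. by move/index_descent/ltnW; rewrite index_mem. Qed.

Lemma descents_nil_sorted w : uniq w -> descents w = [::] -> sorted ltn w.
Proof.
elim: w => [|a [|b s] IHs] //; rewrite descents_cons2 => /andP[].
rewrite inE negb_or => /andP[ab _] us; case: ltngtP ab => //= lt_ab _ ds.
by rewrite lt_ab; apply: IHs.
Qed.

Lemma bigmax_mem (a : nat) s : \max_(x <- a :: s) x \in a :: s.
Proof.
elim: s a => [|b s IHs] a; first by rewrite big_seq1 inE.
rewrite big_cons; case: leqP => _; last by rewrite inE eqxx.
by rewrite inE IHs orbT.
Qed.

Lemma max_descent_in w : uniq w -> ~~ sorted ltn w ->
  \max_(x <- descents w) x \in descents w.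
Proof.
move=> uw nsw; case E: (descents w) => [|a s]; last exact: bigmax_mem.
by rewrite (descents_nil_sorted uw E) in nsw.
Qed.

Lemma max_descent_max A y b B : below y A -> below y (b :: B) ->
  \max_(x <- descents (A ++ y :: b :: B)) x = y.
Proof.
move=> /allP yA yB; have /allP yB' := yB.
apply/eqP; rewrite eqn_leq; apply/andP; split.
  apply/bigmax_leqP_seq => x /mem_descents + _.
  rewrite mem_cat inE => /or3P[/yA /ltnW // | /eqP -> // | /yB' /ltnW //].
suff : y \in descents (A ++ y :: b :: B) by move/leq_bigmax_seq; apply.
elim: A {yA} => [|a A IHA].
  by rewrite descents_cons2; case/andP: yB => -> _; rewrite inE eqxx.
rewrite cat_cons; case: (A ++ _) IHA => // c s IHA.
by rewrite descents_cons2; case: ifP; rewrite ?inE IHA ?orbT.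
Qed.

Lemma descents_rcons A y : below y A -> descents (rcons A y) = descents A.
Proof.
elim: A => [|a [|b A] IHA] //.
  by move=> /andP[/= ay _]; rewrite /descents /= ltnNge ltnW.
move=> /andP[ay yA]; rewrite !rcons_cons !descents_cons2 -rcons_cons.
by rewrite IHA.
Qed.

Lemma sorted_rcons_below A y : below y A -> sorted ltn (rcons A y) = sorted ltn A.
Proof.
case: A => // a A /allP yA; rewrite rcons_cons /= rcons_path.
by rewrite /= (yA (last a A)) ?mem_last ?andbT.
Qed.

Lemma unsorted_max A y b B : below y (b :: B) ->
  sorted ltn (A ++ y :: b :: B) = false.
Proof.
move=> /andP[/= lby _]; apply/negP => /cat_sorted2[_ /= /andP[]].
by rewrite ltnNge ltnW.
Qed.

Lemma index_max A y B : below y A -> index y (A ++ y :: B) = size A.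
Proof.
by move=> /below_notin yA; rewrite index_cat (negPf yA) /= eqxx addn0.
Qed.

(** * Rix-factorization and the first letter of beta *)

Lemma rix_fact_fuel f g w : size w <= f -> size w <= g ->
  rix_fact_rec f w = rix_fact_rec g w.
Proof.
elim: f g w => [|f IHf] [|g] [|a s] //= sf sg.
case: ifP => // _; case: ifP => // _.
by rewrite (IHf g) // size_drop; lia.
Qed.

(** A larger last letter changes neither the descents nor sortedness, so the same cuts are made and
    y travels along to the end of beta. *)
Lemma rix_fact_rcons f A y : uniq A -> below y A ->
  (rix_fact_rec f (rcons A y)).2 = rcons (rix_fact_rec f A).2 y.
Proof.
elim: f A => [|f IHf] A //= uA yA.
rewrite sorted_rcons_below // descents_rcons //.
case: ifP => // /negbT nsA; have /index_descent lt := max_descent_in uA nsA.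
have mA := mem_descents (max_descent_in uA nsA).
have -> : index (\max_(x <- descents A) x) (rcons A y) =
          index (\max_(x <- descents A) x) A by rewrite -cats1 index_cat mA.
case: ifP => // _; set i := index _ A in lt *.
have -> : drop i.+1 (rcons A y) = rcons (drop i.+1 A) y.
  by rewrite -!cats1 drop_cat lt.
have := IHf (drop i.+1 A) (drop_uniq _ uA); case: rix_fact_rec => al be.
case: rix_fact_rec => al' be' /= -> //.
by apply/allP => x /mem_drop; apply: (allP yA).
Qed.

(** Each cut is made after a descent, which is never the last letter. Hence [beta1] of a nonempty
    word is a genuine letter, not the default of [head]. *)
Lemma rix_fact_neq0 f w : uniq w -> w != [::] -> (rix_fact_rec f w).2 != [::].
Proof.
elim: f w => [|f IHf] w //= uw w0.
case: ifP => // /negbT nsw; case: ifP => // _.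
have lt := index_descent (max_descent_in uw nsw).
have := IHf (drop (index (\max_(x <- descents w) x) w).+1 w).
rewrite drop_uniq // => /(_ isT).
case: rix_fact_rec => al be; apply.
by rewrite -size_eq0 size_drop subn_eq0 -ltnNge.
Qed.

Lemma rix_fact_sub f w : {subset (rix_fact_rec f w).2 <= w}.
Proof.
elim: f w => [|f IHf] w //= x; case: ifP => // _; case: ifP => // _.
have := IHf (drop (index (\max_(x <- descents w) x) w).+1 w) x.
by case: rix_fact_rec => al be H /H; apply: mem_drop.
Qed.

Lemma beta1_rcons A y : uniq A -> below y A -> A != [::] ->
  beta1 (rcons A y) = beta1 A.
Proof.
move=> uA yA A0; rewrite /beta1 /rix_factorization rix_fact_rcons //.
rewrite (@rix_fact_fuel _ (size A)) ?size_rcons //.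
by have := rix_fact_neq0 (size A) uA A0; case: (rix_fact_rec _ _).2.
Qed.

Lemma beta1_in w : uniq w -> w != [::] -> beta1 w \in w.
Proof.
move=> uw w0; apply: (@rix_fact_sub (size w)).
have := rix_fact_neq0 (size w) uw w0; rewrite /beta1 /rix_factorization.
by case: (rix_fact_rec _ _).2 => //= a s; rewrite inE eqxx.
Qed.

(** Either the word is y alone, or y is its largest descent with nothing before it; in both cases
    the procedure stops at once with the whole word as beta. *)
Lemma beta1_max_head y B : below y B -> beta1 (y :: B) = y.
Proof.
case: B => [|b B] // yB; rewrite /beta1 /rix_factorization.
have := @unsorted_max [::] _ _ _ yB; have := @max_descent_max [::] _ _ _ isT yB.
by rewrite !cat0s [size _]/= [rix_fact_rec _ _]/= => -> /= ->; rewrite eqxx.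
Qed.

(** The largest descent is y, and since A is nonempty the first cut falls right after y, leaving B
    to be factored. *)
Lemma beta1_max_mid A y B : below y A -> below y B -> A != [::] -> B != [::] ->
  beta1 (A ++ y :: B) = beta1 B.
Proof.
case: B => // b B yA yB A0 _; rewrite /beta1 /rix_factorization.
(* The extra unit of fuel exposes one step of the recursion. *)
rewrite (@rix_fact_fuel _ (size (A ++ y :: b :: B)).+1) //.
rewrite [rix_fact_rec _.+1 _]/= unsorted_max // max_descent_max // index_max //.
rewrite size_eq0 (negPf A0).
have -> : drop (size A).+1 (A ++ y :: b :: B) = b :: B.
  by rewrite -cat_rcons -(size_rcons A y) drop_size_cat.
rewrite (@rix_fact_fuel _ (size (b :: B))) //; first by case: rix_fact_rec.
by rewrite size_cat /=; lia.
Qed.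

(** * Maximal increasing suffix and rixed points of words *)

Lemma max_increasing_suffix_cons a s : max_increasing_suffix (a :: s) =
  if sorted ltn (a :: s) then a :: s else max_increasing_suffix s.
Proof.
rewrite /max_increasing_suffix /=.
by case: ifP => //= _; rewrite (iotaDl 1 0) find_map.
Qed.

Lemma max_increasing_suffix_rcons A y : below y A ->
  max_increasing_suffix (rcons A y) = rcons (max_increasing_suffix A) y.
Proof.
elim: A => [|a A IHA] // yA.
rewrite rcons_cons !max_increasing_suffix_cons -rcons_cons sorted_rcons_below //.
by case: ifP => // _; apply: IHA; case/andP: yA.
Qed.

Lemma max_increasing_suffix_max A y b B : below y (b :: B) ->
  max_increasing_suffix (A ++ y :: b :: B) = max_increasing_suffix (b :: B).
Proof.
move=> yB; elim: A => [|a A IHA].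
  by rewrite cat0s max_increasing_suffix_cons (unsorted_max [::] yB).
by rewrite cat_cons max_increasing_suffix_cons (unsorted_max (a :: A) yB).
Qed.

Definition rix_word (w : seq nat) : nat :=
  count (leq (beta1 w)) (max_increasing_suffix w).

(** The letter y extends the increasing suffix and is one more rixed point: for nonempty A it lies
    above the unchanged [beta1], and for empty A it is [beta1] itself. *)
Lemma rix_word_rcons A y : uniq A -> below y A ->
  rix_word (rcons A y) = (rix_word A).+1.
Proof.
move=> uA yA; have [->|A0] := eqVneq A [::].
  by rewrite /rix_word /= /max_increasing_suffix /= leqnn.
rewrite /rix_word beta1_rcons // max_increasing_suffix_rcons // -cats1 count_cat /=.
by rewrite (ltnW (allP yA _ (beta1_in uA A0))) addn1.
Qed.

(** Here [beta1] is y, while the increasing suffix lies inside B, below y. *)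
Lemma rix_word_max_head y B : below y B -> B != [::] -> rix_word (y :: B) = 0.
Proof.
case: B => // b B yB _; rewrite /rix_word beta1_max_head //.
rewrite (max_increasing_suffix_max [::]) //.
apply/eqP; rewrite -leqn0 leqNgt -has_count; apply/hasPn => x.
by move=> /mem_drop /(allP yB); rewrite -ltnNge.
Qed.

Lemma rix_word_max_mid A y B : below y A -> below y B ->
  A != [::] -> B != [::] -> rix_word (A ++ y :: B) = rix_word B.
Proof.
move=> yA yB A0 B0; rewrite /rix_word beta1_max_mid //.
by case: B B0 yB => // b B _ yB; rewrite max_increasing_suffix_max.
Qed.

Lemma rix_wordE n (pi : 'S_n) : rix pi = rix_word (word pi).
Proof.
rewrite /rix /Rix cardsE cardE /rix_word -size_filter -(size_map val).
apply: perm_size; apply: uniq_perm.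
- by rewrite map_inj_uniq ?enum_uniq //; apply: val_inj.
- by rewrite filter_uniq // drop_uniq // word_uniq.
move=> x; rewrite mem_filter; apply/mapP/andP => [[i + ->]|[bx xw]].
  by rewrite mem_enum => /andP[].
have xn : x < n by rewrite -(mem_word pi); apply: mem_drop xw.
by exists (Ordinal xn); rewrite // mem_enum; apply/andP.
Qed.

(** * Decreasing binary trees *)

Inductive tree := Leaf | Node of tree & nat & tree.

Definition is_leaf t := if t is Leaf then true else false.

Fixpoint letters t : seq nat :=
  if t is Node l y r then letters l ++ y :: letters r else [::].

Fixpoint decreasing t : bool :=
  if t is Node l y r then
    [&& below y (letters l), below y (letters r), decreasing l & decreasing r]
  else true.

Lemma letters_eq0 t : (letters t == [::]) = is_leaf t.
Proof. by case: t => //= l y r; case: (letters l). Qed.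

(** Strong induction on the length, splitting at the largest letter; the absence of repetitions
    makes all other letters strictly smaller. *)
Lemma decreasing_treeP w : uniq w -> exists2 t, decreasing t & letters t = w.
Proof.
have [m] := ubnP (size w); elim: m w => // m IHm [|a s] sm uw.
  by exists Leaf.
set y := \max_(x <- a :: s) x; have yw : y \in a :: s by apply: bigmax_mem.
have ymax x : x \in a :: s -> x <= y by move/leq_bigmax_seq; apply.
case/splitPr: yw ymax uw sm => A B ymax; rewrite uniq_catC /= mem_cat negb_or.
move=> /andP[/andP[yB yA]]; rewrite -uniq_catC cat_uniq => /and3P[uA _ uB].
rewrite size_cat /= addnS ltnS => sm.
have [l dl lA] := IHm A (leq_ltn_trans (leq_addr _ _) sm) uA.
have [r dr rB] := IHm B (leq_ltn_trans (leq_addl _ _) sm) uB.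
exists (Node l y r); rewrite /= lA rB // dl dr !andbT; apply/andP; split.
  apply/allP => x xA; rewrite ltn_neqAle ymax ?mem_cat ?xA // andbT.
  by apply: contraNneq yA => <-.
apply/allP => x xB; rewrite ltn_neqAle ymax ?mem_cat ?inE ?xB ?orbT // andbT.
by apply: contraNneq yB => <-.
Qed.

(* A letter is a double ascent or a double descent exactly when one of its two
   subtrees is empty and the other is not; hopping it then swaps them. *)
Fixpoint hop_tree (P : pred nat) t : seq nat :=
  if t is Node l y r then
    if P y && (is_leaf l || is_leaf r)
    then hop_tree P r ++ y :: hop_tree P l
    else hop_tree P l ++ y :: hop_tree P r
  else [::].

Lemma hop_tree_perm P t : perm_eq (hop_tree P t) (letters t).
Proof.
elim: t => //= l IHl y r IHr; apply/seq.permP => p.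
by case: ifP => _; rewrite !count_cat /= (seq.permP IHl) (seq.permP IHr) //
  addnC -addnA addnCA.
Qed.

Lemma eq_hop_tree P Q t : {in letters t, P =1 Q} -> hop_tree P t = hop_tree Q t.
Proof.
elim: t => //= l IHl y r IHr PQ.
rewrite IHl ?IHr ?PQ ?mem_cat ?inE ?eqxx ?orbT // => x xt; apply: PQ;
  by rewrite mem_cat inE xt ?orbT.
Qed.

Lemma hop_tree_pred0 t : hop_tree pred0 t = letters t.
Proof. by elim: t => //= l -> y r ->. Qed.

(** * Locality of hopping in words *)

Lemma hop_word_split x l r : x \notin l ->
  let a := size l - find (leq x) (rev l) in
  let b := find (leq x) r in
  let u := last None (map Some l) in
  let v := head None (map Some r) in
  hop_word x (l ++ x :: r) =
  if lt_inf u (Some x) && lt_inf (Some x) v ||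
     lt_inf (Some x) u && lt_inf v (Some x)
  then take a l ++ take b r ++ x :: drop a l ++ drop b r else l ++ x :: r.
Proof.
move=> xl a b u v; rewrite /hop_word /double_ascent /double_descent /position.
have -> : index x (l ++ x :: r) = size l.
  by rewrite index_cat (negPf xl) /= eqxx addn0.
rewrite take_size_cat // -cat_rcons drop_size_cat ?size_rcons //.
(* The leading [None] shifts indices by one: index [size l] reads the last letter of l, or infinity
   when l is empty. *)
have -> : letter (rcons l x ++ r) (size l) = u.
  rewrite /letter map_cat map_rcons cat_rcons -cat_cons nth_cat /= size_map ltnS leqnn.
  by rewrite -(size_map Some l) nth_last.
have -> : letter (rcons l x ++ r) (size l).+1 = Some x.
  by rewrite /letter /= map_cat map_rcons cat_rcons nth_cat size_map ltnn subnn.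
have -> // : letter (rcons l x ++ r) (size l).+2 = v.
rewrite /letter /= map_cat nth_cat size_map size_rcons ltnn subnn.
by rewrite /v; case: (r).
Qed.

(** A letter y larger than x ends every run of letters smaller than x, so nothing beyond y is
    seen. *)
Lemma find_leq_cat x y s t : x < y ->
  find (leq x) (s ++ y :: t) = find (leq x) s.
Proof.
move=> xy; rewrite find_cat /= (ltnW xy) addn0; case: ifP => // /negbT hs.
by rewrite hasNfind.
Qed.

Lemma split_index x (A : seq nat) : x \in A ->
  exists l r : seq nat, A = l ++ x :: r /\ x \notin l.
Proof.
elim: A => // a A IHA; rewrite inE; have [<- _|ne /= /IHA[l [r [-> xl]]]] := eqVneq x a.
  by exists [::], A.
by exists (a :: l), r; rewrite inE negb_or ne.
Qed.

(** Seen from x, the larger letter y acts as the infinity that bounds A on the right: it stops the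
    run and compares with x in the same way. *)
Lemma hop_word_catl x y A B : x < y -> x \in A ->
  hop_word x (A ++ y :: B) = hop_word x A ++ y :: B.
Proof.
move=> xy /split_index[l [r [-> xl]]]; rewrite -catA cat_cons !hop_word_split //.
rewrite find_leq_cat //.
have -> : take (find (leq x) r) (r ++ y :: B) = take (find (leq x) r) r.
  by rewrite takel_cat ?find_size.
have -> : drop (find (leq x) r) (r ++ y :: B) = drop (find (leq x) r) r ++ y :: B.
  rewrite drop_cat; case: ltnP => // le.
  by rewrite (eqP (find_size _ _)) drop0 [X in _ = X ++ _]drop_oversize.
have -> : lt_inf (Some x) (head None (map Some (r ++ y :: B))) =
          lt_inf (Some x) (head None (map Some r)) by case: (r).
have -> : lt_inf (head None (map Some (r ++ y :: B))) (Some x) =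
          lt_inf (head None (map Some r)) (Some x).
  by case: (r) => //=; rewrite ltnNge (ltnW xy).
by case: ifP => _; rewrite -!catA //= -!catA.
Qed.

(** Mirror image, with y as the infinity to the left of B; [x \notin A] makes [index] point into
    B. *)
Lemma hop_word_catr x y A B : x < y -> x \notin A -> x \in B ->
  hop_word x (A ++ y :: B) = A ++ y :: hop_word x B.
Proof.
move=> xy xA /split_index[l [r [-> xl]]].
have xAl : x \notin rcons A y ++ l.
  by rewrite mem_cat mem_rcons inE !negb_or xA xl neq_ltn xy.
rewrite -(cat_rcons y A (l ++ _)) catA !hop_word_split //.
rewrite rev_cat rev_rcons find_leq_cat // size_cat.
have -> : size (rcons A y) + size l - find (leq x) (rev l) =
          size (rcons A y) + (size l - find (leq x) (rev l)).
  by rewrite addnBA // -(size_rev l) find_size.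
rewrite take_cat drop_cat ltnNge leq_addr addKn [~~ true]/=.
rewrite map_cat last_cat map_rcons last_rcons.
have -> : lt_inf (Some x) (last (Some y) (map Some l)) =
          lt_inf (Some x) (last None (map Some l)) by case: (l).
have -> : lt_inf (last (Some y) (map Some l)) (Some x) =
          lt_inf (last None (map Some l)) (Some x).
  by case: (l) => //=; rewrite ltnNge (ltnW xy).
by case: ifP => _; rewrite -!catA cat_rcons.
Qed.

(** The two runs are all of A and all of B. The letter y is a peak if both are nonempty, a double
    ascent or descent if exactly one is; if both are empty it is a valley, and the swap changes
    nothing. *)
Lemma hop_word_max y A B : below y A -> below y B ->
  hop_word y (A ++ y :: B) =
  if (A == [::]) || (B == [::]) then B ++ y :: A else A ++ y :: B.
Proof.
move=> yA yB; rewrite hop_word_split ?below_notin //.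
have noleq s : below y s -> find (leq y) s = size s.
  move=> ys; rewrite hasNfind //; apply/hasPn => x xs.
  by rewrite -ltnNge (allP ys).
rewrite !noleq // ?size_rev; last by rewrite /below all_rev.
rewrite subnn take0 drop0 take_size drop_size cats0.
have -> : lt_inf (last None (map Some A)) (Some y) = (A != [::]).
  case/lastP: A yA => // A a.
  by rewrite map_rcons last_rcons /below all_rcons => /andP[]; case: A.
have -> : lt_inf (Some y) (last None (map Some A)) = (A == [::]).
  case/lastP: A yA => // A a; rewrite map_rcons last_rcons /below all_rcons.
  by case/andP=> /= ay _; rewrite ltnNge ltnW //; case: A.
have -> : lt_inf (head None (map Some B)) (Some y) = (B != [::]).
  by case: B yB => //= b B /andP[].
have -> : lt_inf (Some y) (head None (map Some B)) = (B == [::]).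
  by case: B yB => //= b B /andP[ay _]; rewrite ltnNge ltnW.
by case: A {yA} => [|? ?]; case: B {yB}.
Qed.

(** * Hopping and orbits on decreasing trees *)

Lemma hop_tree_eq0 P t : (hop_tree P t == [::]) = is_leaf t.
Proof. by rewrite -letters_eq0 -!size_eq0 (perm_size (hop_tree_perm P t)). Qed.

Lemma below_hop_tree y P t : below y (hop_tree P t) = below y (letters t).
Proof. exact/perm_all/hop_tree_perm. Qed.

Lemma mem_hop_tree P t : hop_tree P t =i letters t.
Proof. exact/perm_mem/hop_tree_perm. Qed.

(** With P recording the swapped letters, a hop toggles x in P. A hop at the root is [hop_word_max];
    below it, the larger root letter shields the other subtree, which stands on either side
    according to whether the root was swapped. *)
Lemma hop_word_tree x P t : decreasing t -> uniq (letters t) -> x \in letters t ->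
  hop_word x (hop_tree P t) = hop_tree (fun z => (z == x) (+) P z) t.
Proof.
elim: t => //= l IHl y r IHr /and4P[yl yr dl dr].
rewrite cat_uniq /= => /and4P[ul /norP[ynl lr] ynr ur] xt.
have noflip t : x \notin letters t ->
    hop_tree (fun z => (z == x) (+) P z) t = hop_tree P t.
  move=> xnt; apply: eq_hop_tree => z zt.
  by have [zx|//] := eqVneq z x; rewrite -zx zt in xnt.
have [yx|ne] := eqVneq y x.
  rewrite -yx in noflip *.
  rewrite (noflip l) ?(noflip r) //=.
  (* If the swap at the root has been made, the hop undoes it. *)
  case: (P y) => /=; last by rewrite hop_word_max ?below_hop_tree // !hop_tree_eq0.
  case: ifP => leaf_lr; rewrite hop_word_max ?below_hop_tree // !hop_tree_eq0.
    by rewrite orbC leaf_lr.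
  by rewrite leaf_lr.
rewrite /=; move: xt; rewrite mem_cat inE eq_sym (negPf ne) => /orP[xl|/= xr].
  have xr : x \notin letters r by apply/negP => xr; case/hasP: lr; exists x.
  rewrite -IHl // (noflip r) //; have xy := allP yl _ xl.
  by case: ifP => _;
    [rewrite hop_word_catr // ?mem_hop_tree|rewrite hop_word_catl // ?mem_hop_tree].
have xl : x \notin letters l by apply/negP => xl; case/hasP: lr; exists x.
rewrite -IHr // (noflip l) //; have xy := allP yr _ xr.
by case: ifP => _;
  [rewrite hop_word_catl // ?mem_hop_tree|rewrite hop_word_catr // ?mem_hop_tree].
Qed.

(** Starting from [pred0], each letter of the repetition-free s is toggled exactly once. *)
Lemma hop_words_tree s t : decreasing t -> uniq (letters t) ->
  uniq s -> {subset s <= letters t} ->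
  foldr hop_word (letters t) s = hop_tree [in s] t.
Proof.
move=> dt ut; elim: s => [|x s IHs] /=; first by rewrite -hop_tree_pred0.
move=> /andP[xs us] st; rewrite IHs // => [|z zs]; last by rewrite st ?inE ?zs ?orbT.
rewrite hop_word_tree ?st ?inE ?eqxx //; apply: eq_hop_tree => z _.
by rewrite !inE; have [->|] := eqVneq z x; rewrite ?(negPf xs).
Qed.

(** Swapped words are added only when exactly one subtree is empty: with two nonempty subtrees the
    root does not move, and with two empty ones the same word would be listed twice. *)
Fixpoint tree_orbit t : seq (seq nat) :=
  if t is Node l y r then
    [seq a ++ y :: b | a <- tree_orbit l, b <- tree_orbit r] ++
    (if is_leaf l (+) is_leaf r
     then [seq b ++ y :: a | a <- tree_orbit l, b <- tree_orbit r] else [::])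
  else [:: [::]].

Lemma hop_tree_orbit P t : hop_tree P t \in tree_orbit t.
Proof.
elim: t => //= l IHl y r IHr; rewrite mem_cat.
have lr : hop_tree P l ++ y :: hop_tree P r \in
    [seq a ++ y :: b | a <- tree_orbit l, b <- tree_orbit r].
  by apply/allpairsP; exists (hop_tree P l, hop_tree P r).
case: ifP => [/andP[_ leaf_lr]|]; last by rewrite lr.
case: ifP => [_|b]; apply/orP.
  by right; apply/allpairsP; exists (hop_tree P l, hop_tree P r).
(* Both subtrees are empty here, so the swapped and unswapped words coincide. *)
by left; move: lr; case: (l) leaf_lr b => [|? ? ?]; case: (r).
Qed.

Lemma tree_orbitP t v : uniq (letters t) ->
  reflect (exists P, v = hop_tree P t) (v \in tree_orbit t).
Proof.
move=> ut; apply: (iffP idP) => [|[P ->]]; last exact: hop_tree_orbit.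
elim: t ut v => [|l IHl y r IHr] /=.
  by move=> _ v; rewrite inE => /eqP ->; exists pred0.
rewrite cat_uniq /= => /and4P[ul /norP[ynl lr] ynr ur] v.
(* The letters of l, those of r and y are disjoint, so independent choices on the three merge into
   one predicate. *)
have glue a b c : a \in tree_orbit l -> b \in tree_orbit r ->
    exists P, [/\ P y = c, a = hop_tree P l & b = hop_tree P r].
  move=> /(IHl ul)[Pl ->] /(IHr ur)[Pr ->].
  exists (fun z => if z \in letters l then Pl z else
                   if z \in letters r then Pr z else c).
  rewrite (negPf ynl) (negPf ynr); split=> //; apply: eq_hop_tree => z zt.
    by rewrite zt.
  by rewrite zt; case: ifP => // zl; case/hasP: lr; exists z.
rewrite mem_cat => /orP[|].
  case/allpairsP=> -[a b] /= [al br ->].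
  by have [P [Py -> ->]] := glue _ _ false al br; exists P; rewrite Py.
case: ifP => // leaf_lr /allpairsP[[a b] /= [al br ->]].
have [P [Py -> ->]] := glue _ _ true al br; exists P; rewrite Py.
by case: (is_leaf l) (is_leaf r) leaf_lr => [] [].
Qed.

Lemma tree_orbit_perm t v : uniq (letters t) -> v \in tree_orbit t ->
  perm_eq v (letters t).
Proof. by move=> ut /(tree_orbitP _ ut)[P ->]; apply: hop_tree_perm. Qed.

(** The index of the first y fixes where to cut. *)
Lemma cat_notin_inj (y : nat) a b c d : y \notin a -> y \notin c ->
  a ++ y :: b = c ++ y :: d -> a = c /\ b = d.
Proof.
move=> ya yc e; have := congr1 (index y) e.
rewrite !index_cat (negPf ya) (negPf yc) /= eqxx !addn0 => sz.
by move/eqP: e; rewrite eqseq_cat // eqseq_cons eqxx /= => /andP[/eqP-> /eqP->].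
Qed.

Lemma tree_orbit_uniq t : uniq (letters t) -> uniq (tree_orbit t).
Proof.
elim: t => //= l IHl y r IHr.
rewrite cat_uniq /= => /and4P[ul /norP[ynl _] ynr ur].
have yl a : a \in tree_orbit l -> y \notin a.
  by move/(tree_orbit_perm ul)/perm_mem->.
have yr b : b \in tree_orbit r -> y \notin b.
  by move/(tree_orbit_perm ur)/perm_mem->.
rewrite cat_uniq; apply/and3P; split.
- apply: allpairs_uniq; [exact: IHl|exact: IHr|].
  move=> [a b] [c d] /allpairsP[[? ?] [/= al _ [-> _]]].
  move=> /allpairsP[[? ?] [/= cl _ [-> _]]] /=.
  by case/cat_notin_inj => [||-> ->]; rewrite ?yl.
(* A word in both lists would have one and the same piece before y, giving l and r equally many
   letters although exactly one of them is empty. *)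
- case: ifP => // leaf_lr; apply/hasPn => v /allpairsP[[b c] /= [bl cr ->]].
  apply/negP => /allpairsP[[a d] /= [al dr]].
  case/(cat_notin_inj (yr _ cr) (yl _ al)) => ca _.
  move: leaf_lr; rewrite -!letters_eq0 -!size_eq0.
  rewrite -(perm_size (tree_orbit_perm ul al)) -(perm_size (tree_orbit_perm ur cr)) ca.
  by rewrite addbb.
case: ifP => // _; apply: allpairs_uniq; [exact: IHl|exact: IHr|].
move=> [a b] [c d] /allpairsP[[? ?] [/= _ br [_ ->]]].
move=> /allpairsP[[? ?] [/= _ dr [_ ->]]] /=.
by case/cat_notin_inj => [||-> ->]; rewrite ?yr.
Qed.

(** Mean value 1, stated without division. The leaf is an exception: its only word is empty and has
    no rixed point. *)
Lemma sum_rix_tree_orbit t : decreasing t -> uniq (letters t) ->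
  \sum_(v <- tree_orbit t) rix_word v =
  if is_leaf t then 0 else size (tree_orbit t).
Proof.
elim: t => [_ _|l IHl y r IHr] /=; first by rewrite big_seq1.
move=> /and4P[yl yr dl dr]; rewrite cat_uniq /= => /and4P[ul _ ynr ur].
have facts t v : uniq (letters t) -> below y (letters t) -> v \in tree_orbit t ->
    [/\ uniq v, below y v & (v == [::]) = is_leaf t].
  move=> ut yt vt; have pv := tree_orbit_perm ut vt.
  rewrite (perm_uniq pv) /below (perm_all _ pv) -letters_eq0 -!size_eq0.
  by rewrite (perm_size pv).
have tail t : uniq (letters t) -> below y (letters t) ->
    \sum_(v <- tree_orbit t) rix_word (v ++ [:: y]) =
    \sum_(v <- tree_orbit t) rix_word v + size (tree_orbit t).
  move=> ut yt; rewrite -sum1_size -big_split /=.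
  apply: eq_big_seq => v /(facts _ _ ut yt)[uv yv _].
  by rewrite cats1 rix_word_rcons // addn1.
have head t : uniq (letters t) -> below y (letters t) -> ~~ is_leaf t ->
    \sum_(v <- tree_orbit t) rix_word (y :: v) = 0.
  move=> ut yt tn; rewrite big1_seq // => v /andP[_ /(facts _ _ ut yt)[uv yv v0]].
  by rewrite rix_word_max_head ?v0.
have {}IHl := IHl dl ul; have {}IHr := IHr dr ur.
rewrite big_cat big_allpairs_dep /= size_cat size_allpairs.
have [Ll|Nl] := boolP (is_leaf l); have [Lr|Nr] := boolP (is_leaf r) => /=.
- case: l r Ll Lr {IHl IHr yl yr dl dr ul ur ynr} => [|? ? ?] [|? ? ?] // _ _.
  by rewrite !big_seq1 big_nil (@rix_word_rcons [::]).
(* Only l is empty: the words y B contribute 0 and the words B y contribute rix B + 1, in total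
   twice the orbit size of r. *)
- rewrite big_allpairs_dep size_allpairs; case: l Ll {IHl yl dl ul} => // _.
  by rewrite /= !big_seq1 head // tail // IHr (negPf Nr) !mul1n.
- rewrite big_allpairs_dep size_allpairs; case: r Lr {IHr yr dr ur ynr} => // _.
  under eq_bigr do rewrite big_seq1.
  under [X in _ + X = _]eq_bigr do rewrite big_seq1.
  by rewrite /= head // tail // IHl (negPf Nl) !muln1 addn0.
(* Both subtrees are nonempty: for each fixed left word, the sum over the right words is the orbit
   size of r by induction. *)
rewrite big_nil !addn0 big_seq (eq_bigr (fun=> size (tree_orbit r))).
  by rewrite -big_seq big_const_seq count_predT iter_addn_0 mulnC.
move=> a al; rewrite (negPf Nr) in IHr; rewrite -IHr; apply: eq_big_seq => b br.
have [_ ya a0] := facts _ _ ul yl al; have [_ yb b0] := facts _ _ ur yr br.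
by rewrite rix_word_max_mid ?a0 ?b0.
Qed.

(** * Passage from words to permutations *)

Theorem theorem22 (n : nat) (hn : 1 <= n) :
  mesic (hop_orbits n) (fun pi : 'S_n => (rix pi)%:R%R) 1%R.
Proof.
move=> _ /imsetP[pi _ ->].
have [t dt tpi] := decreasing_treeP (word_uniq pi).
have ut : uniq (letters t) by rewrite tpi word_uniq.
have word_hop_set S : word (hop_set S pi) = hop_tree [in map val (enum S)] t.
  rewrite -hop_words_tree //.
  - by rewrite /hop_set tpi; elim: (enum S) => //= x s <-; rewrite word_hop.
  - by rewrite map_inj_uniq ?enum_uniq //; apply: val_inj.
  by move=> _ /mapP[x _ ->]; rewrite tpi mem_word ltn_ord.
(* Both lists are free of repetitions, so cardinality and sum transfer from the orbit to
   [tree_orbit t]. *)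
have orbE : perm_eq (map (@word n) (enum (hop_orbit pi))) (tree_orbit t).
  apply: uniq_perm.
  - rewrite map_inj_uniq ?enum_uniq // => s1 s2 e; apply/permP => i.
    by apply: val_inj; rewrite /= -!nth_word e.
  - exact: tree_orbit_uniq.
  move=> v; apply/mapP/(tree_orbitP _ ut) => [[tau]|[P ->]].
    rewrite mem_enum => /imsetP[S _ ->] ->.
    by exists [in map val (enum S)]; apply: word_hop_set.
  (* Only the values of P on the letters of t matter, and these are the numbers below n. *)
  exists (hop_set [set i : 'I_n | P i] pi); first by rewrite mem_enum; apply: imset_f.
  rewrite word_hop_set; apply: eq_hop_tree => z; rewrite tpi mem_word => zn.
  apply/idP/mapP => [Pz|[i + ->]]; last by rewrite mem_enum inE.
  by exists (Ordinal zn); rewrite // mem_enum inE.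
have card_orb : #|hop_orbit pi| = size (tree_orbit t).
  by rewrite cardE -(size_map (@word n)) (perm_size orbE).
rewrite -GRing.natr_sum.
have -> : \sum_(tau in hop_orbit pi) rix tau = #|hop_orbit pi|.
  transitivity (\sum_(v <- tree_orbit t) rix_word v).
    rewrite -(perm_big _ orbE) big_map big_enum.
    by apply: eq_bigr => tau _; rewrite rix_wordE.
  (* As n is positive, t is not a leaf. *)
  by rewrite sum_rix_tree_orbit // card_orb -letters_eq0 tpi -size_eq0 size_word gtn_eqF.
rewrite GRing.mulVf // Num.Theory.pnatr_eq0 -lt0n; apply/card_gt0P.
by exists (hop_set set0 pi); apply: imset_f.
Qed.
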